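(* Let $K$ be a compact convex set in $\mathbb{R}^n$ with nonempty interior and $\alpha$ a sequence of unit vectors. Suppose that for every subsequential limit $L$ of $\mathrm{s}_\alpha K$, the limit $\mathrm{s}_\alpha L$ exists and $\mathrm{s}_\alpha L=L$. Then $\mathrm{s}_\alpha K$ exists (i.e. the Steiner process converges).
   Context: For a nonempty compact convex $K\subseteq\mathbb{R}^n$ and a unit vector $u$, the Steiner symmetrization $\mathrm{s}_uK$ is defined as follows: for each point $x$ of the orthogonal projection $\pi_uK$ of $K$ onto $u^\perp$, let $\ell_x(K)$ be the length of the segment $K\cap(x+\mathbb{R}u)$; then $\mathrm{s}_uK=\{x+tu:\ x\in\pi_uK,\ |t|\le \tfrac12\ell_x(K)\}$. Given a sequence $\alpha=(u_1,u_2,\dots)$ of unit vectors and $K$, the Steiner process is the sequence $K_i=\mathrm{s}_{u_i}\cdots\mathrm{s}_{u_1}K$; if $\lim_iK_i$ exists in the Hausdorff metric it is denoted $\mathrm{s}_\alpha K$, and a limit of a convergent subsequence of $(K_i)$ is called a subsequential limit of $\mathrm{s}_\alpha K$. *)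

(* Defs.v *)
From Stdlib Require Import Reals Lra.
Open Scope R_scope.

(* Points of R^n are represented by functions nat -> R vanishing at all
   indices >= n. *)
Definition point := nat -> R.

Definition in_Rn (n : nat) (x : point) : Prop :=
  forall i, (n <= i)%nat -> x i = 0.

Fixpoint rsum (n : nat) (f : nat -> R) : R :=
  match n with
  | O => 0
  | S m => rsum m f + f m
  end.

Definition dot (n : nat) (x y : point) : R := rsum n (fun i => x i * y i).
Definition vnorm (n : nat) (x : point) : R := sqrt (dot n x x).
Definition dist (n : nat) (x y : point) : R := vnorm n (fun i => x i - y i).

Definition vadd (x y : point) : point := fun i => x i + y i.
Definition vscale (t : R) (x : point) : point := fun i => t * x i.

Definition unit_vector (n : nat) (u : point) : Prop :=
  in_Rn n u /\ vnorm n u = 1.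

Definition rset := point -> Prop.

Definition convex (K : rset) : Prop :=
  forall x y t, K x -> K y -> 0 <= t <= 1 ->
    K (vadd (vscale (1 - t) x) (vscale t y)).

Definition bounded (n : nat) (K : rset) : Prop :=
  exists M, forall x, K x -> vnorm n x <= M.

Definition closed (n : nat) (K : rset) : Prop :=
  forall x, in_Rn n x ->
    (forall eps, 0 < eps -> exists y, K y /\ dist n x y < eps) -> K x.

Definition compact_convex (n : nat) (K : rset) : Prop :=
  (forall x, K x -> in_Rn n x) /\ (exists x, K x) /\
  convex K /\ bounded n K /\ closed n K.

Definition nonempty_interior (n : nat) (K : rset) : Prop :=
  exists x r, in_Rn n x /\ 0 < r /\
    forall y, in_Rn n y -> dist n x y < r -> K y.

(* Steiner symmetrization.  For y in R^n, write y = x + t u with x in u^perp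
   (x = y - <y,u> u, t = <y,u>).  The chord lengths of K on the line x + R u
   are the numbers b - a with x + a u, x + b u in K; their least upper bound
   is the length l_x(K) of the segment K /\ (x + R u).  x lies in the
   projection pi_u K iff this line meets K. *)
Definition line_hits (K : rset) (x u : point) (a : R) : Prop :=
  K (vadd x (vscale a u)).

Definition chord_lengths (K : rset) (x u : point) : R -> Prop :=
  fun l => exists a b, line_hits K x u a /\ line_hits K x u b /\ l = b - a.

Definition steiner (n : nat) (u : point) (K : rset) : rset :=
  fun y =>
    in_Rn n y /\
    let t := dot n y u in
    let x := vadd y (vscale (- t) u) in
    (exists a, line_hits K x u a) /\
    exists l, is_lub (chord_lengths K x u) l /\ Rabs t <= l / 2.

(* The Steiner process K_i = s_{u_i} ... s_{u_1} K, with alpha 0 = u_1. *)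
Fixpoint steiner_process (n : nat) (alpha : nat -> point) (K : rset) (i : nat)
  : rset :=
  match i with
  | O => K
  | S j => steiner n (alpha j) (steiner_process n alpha K j)
  end.

Definition hausdorff_converges (n : nat) (Ks : nat -> rset) (L : rset) : Prop :=
  compact_convex n L /\
  forall eps, 0 < eps -> exists N, forall i, (N <= i)%nat ->
    (forall x, Ks i x -> exists y, L y /\ dist n x y <= eps) /\
    (forall y, L y -> exists x, Ks i x /\ dist n x y <= eps).

Definition steiner_limit_is (n : nat) (alpha : nat -> point) (K L : rset) : Prop :=
  hausdorff_converges n (steiner_process n alpha K) L.

Definition subsequential_limit (n : nat) (alpha : nat -> point) (K L : rset)
  : Prop :=
  exists phi : nat -> nat, (forall i, (phi i < phi (S i))%nat) /\
    hausdorff_converges n (fun i => steiner_process n alpha K (phi i)) L.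

(* Main.v *)
(** Steiner symmetrization is compatible with Minkowski combinations: if
    (1-t)A + tA' is contained in B, then (1-t)s_u A + t s_u A' is contained in
    s_u B.  Take A' to be a point c.  If A lies within Hausdorff distance d of
    B, and B contains the ball of radius r about c with d <= t r, then
    (1-t)A + tc is contained in B, and this inclusion persists along the two
    Steiner processes, with c replaced by its successive projections.  So if
    K_j and L_j are close at one index j, and both contain balls of a fixed
    radius, then K_k and L_k stay close for all k >= j.  Apply this to a
    subsequential limit L of (K_i), given by Blaschke selection: K_j is close
    to L for j far along the subsequence, and L_j is close to L because the
    process of L converges to L.  Hence K_k, staying close to L_k,
    converges to L. *)

From Stdlib Require Import Reals Lra Lia List.
From Stdlib Require Import Classical ClassicalEpsilon FunctionalExtensionality.
Require Import Defs.
Open Scope R_scope.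

(** * Finite sums, inner product, norm and distance on R^n *)

Ltac vext := apply functional_extensionality; intro; unfold vadd, vscale.

Lemma Rabs_le_bounds x a : Rabs x <= a -> - a <= x <= a.
Proof.
  intro H; pose proof (Rle_abs x); pose proof (Rle_abs (- x)).
  rewrite Rabs_Ropp in *; lra.
Qed.

Lemma Rabs_m1 : Rabs (-1) = 1.
Proof. rewrite Rabs_left; lra. Qed.

Lemma rsum_ext n f g : (forall i, f i = g i) -> rsum n f = rsum n g.
Proof. intro H; induction n as [|n IH]; simpl; [easy|now rewrite IH, H]. Qed.

Lemma rsum_plus n f g : rsum n (fun i => f i + g i) = rsum n f + rsum n g.
Proof. induction n as [|n IH]; simpl; [ring|rewrite IH; ring]. Qed.

Lemma rsum_scal n c f : rsum n (fun i => c * f i) = c * rsum n f.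
Proof. induction n as [|n IH]; simpl; [ring|rewrite IH; ring]. Qed.

Lemma rsum_nonneg n f : (forall i, 0 <= f i) -> 0 <= rsum n f.
Proof.
  intro H; induction n as [|n IH]; simpl; [lra|specialize (H n); lra].
Qed.

Lemma rsum_term_le n f i :
  (forall i, 0 <= f i) -> (i < n)%nat -> f i <= rsum n f.
Proof.
  intros H; induction n as [|n IH]; simpl; intro Hi; [lia|].
  destruct (Nat.eq_dec i n) as [->|Hn].
  - pose proof (rsum_nonneg n f H); lra.
  - assert (f i <= rsum n f) by (apply IH; lia). specialize (H n); lra.
Qed.

Lemma rsum_le_const n f c : (forall i, f i <= c) -> rsum n f <= INR n * c.
Proof.
  intro H; induction n as [|n IH]; [simpl; lra|].
  rewrite S_INR; simpl. specialize (H n); lra.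
Qed.

Lemma rsum_cv n (f : nat -> nat -> R) l :
  (forall i, Un_cv (fun j => f j i) (l i)) ->
  Un_cv (fun j => rsum n (f j)) (rsum n l).
Proof.
  intro H; induction n as [|n IH]; simpl.
  - intros e He; exists 0%nat; intros; unfold Rdist.
    rewrite Rminus_diag, Rabs_R0; easy.
  - now apply (CV_plus (fun j => rsum n (f j)) (fun j => f j n)).
Qed.

Lemma dot_comm n x y : dot n x y = dot n y x.
Proof. apply rsum_ext; intro; ring. Qed.

Lemma dot_addl n x y z : dot n (vadd x y) z = dot n x z + dot n y z.
Proof.
  unfold dot; rewrite <- rsum_plus; apply rsum_ext; intro; unfold vadd; ring.
Qed.

Lemma dot_scalel n c x z : dot n (vscale c x) z = c * dot n x z.
Proof.
  unfold dot; rewrite <- rsum_scal; apply rsum_ext; intro; unfold vscale; ring.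
Qed.

Lemma dot_addr n x y z : dot n z (vadd x y) = dot n z x + dot n z y.
Proof. now rewrite dot_comm, dot_addl, !(dot_comm n _ z). Qed.

Lemma dot_scaler n c x z : dot n z (vscale c x) = c * dot n z x.
Proof. now rewrite dot_comm, dot_scalel, (dot_comm n _ z). Qed.

Lemma dot_self_nonneg n x : 0 <= dot n x x.
Proof. apply rsum_nonneg; intro; nra. Qed.

Ltac dots := rewrite ?dot_addl, ?dot_addr, ?dot_scalel, ?dot_scaler,
  ?dot_addr, ?dot_scaler.

(** The quadratic s -> |x - s y|^2 is nonnegative; evaluating it at its minimizer s = <x,y>/<y,y>
    gives the inequality. *)
Lemma cauchy_schwarz n x y : dot n x y * dot n x y <= dot n x x * dot n y y.
Proof.
  pose proof (dot_self_nonneg n x) as Hx.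
  pose proof (dot_self_nonneg n y) as Hy.
  assert (H : forall s, 0 <= dot n x x - 2 * s * dot n x y + s * s * dot n y y).
  { intro s. pose proof (dot_self_nonneg n (vadd x (vscale (- s) y))) as H.
    revert H; dots. rewrite (dot_comm n y x). nra. }
  destruct (Req_dec (dot n y y) 0) as [E|E].
  - rewrite E in *. destruct (Req_dec (dot n x y) 0) as [->|F]; [lra|].
    (* When [dot n y y = 0] the quadratic is affine in s, and this s would give it the value -1. *)
    specialize (H ((dot n x x + 1) / (2 * dot n x y))).
    replace (2 * ((dot n x x + 1) / (2 * dot n x y)) * dot n x y)
      with (dot n x x + 1) in H by (field; easy). lra.
  - specialize (H (dot n x y / dot n y y)).
    replace (dot n x x - 2 * (dot n x y / dot n y y) * dot n x y +
      dot n x y / dot n y y * (dot n x y / dot n y y) * dot n y y)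
      with ((dot n x x * dot n y y - dot n x y * dot n x y) / dot n y y) in H
      by (field; easy).
    assert (0 < dot n y y) by lra.
    apply Rmult_le_compat_r with (r := dot n y y) in H; [|lra].
    unfold Rdiv in H; rewrite Rmult_assoc, Rinv_l in H by easy. lra.
Qed.

Lemma vnorm_nonneg n x : 0 <= vnorm n x.
Proof. apply sqrt_pos. Qed.

Lemma vnorm_sqr n x : vnorm n x * vnorm n x = dot n x x.
Proof. apply sqrt_sqrt, dot_self_nonneg. Qed.

Lemma vnorm_le n x r : 0 <= r -> dot n x x <= r * r -> vnorm n x <= r.
Proof.
  intros Hr H. rewrite <- vnorm_sqr in H. pose proof (vnorm_nonneg n x). nra.
Qed.

Lemma vnorm_triangle n x y : vnorm n (vadd x y) <= vnorm n x + vnorm n y.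
Proof.
  pose proof (vnorm_nonneg n x). pose proof (vnorm_nonneg n y).
  apply vnorm_le; [lra|]. dots. rewrite (dot_comm n y x).
  pose proof (cauchy_schwarz n x y) as C. rewrite <- !vnorm_sqr in *.
  assert (dot n x y <= vnorm n x * vnorm n y).
  { assert (0 <= vnorm n x * vnorm n y) by nra. nra. }
  nra.
Qed.

Lemma vnorm_scale n c x : vnorm n (vscale c x) = Rabs c * vnorm n x.
Proof.
  unfold vnorm. dots. rewrite <- Rmult_assoc.
  rewrite sqrt_mult_alt by nra. f_equal. apply sqrt_Rsqr_abs.
Qed.

Lemma coord_le_vnorm n x i : in_Rn n x -> Rabs (x i) <= vnorm n x.
Proof.
  intro Hx. destruct (Nat.lt_ge_cases i n) as [Hi|Hi].
  - pose proof (rsum_term_le n (fun i => x i * x i) i ltac:(intro; nra) Hi) as H.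
    fold (dot n x x) in H. rewrite <- vnorm_sqr in H.
    pose proof (vnorm_nonneg n x). apply Rabs_le; split; nra.
  - rewrite Hx, Rabs_R0 by easy. apply vnorm_nonneg.
Qed.

(** The factor n, cruder than sqrt n, comes from n <= n^2 for natural n. *)
Lemma vnorm_le_sup n x e :
  0 <= e -> (forall i, Rabs (x i) <= e) -> vnorm n x <= INR n * e.
Proof.
  intros He H. pose proof (pos_INR n) as Hn. apply vnorm_le; [nra|].
  assert (dot n x x <= INR n * (e * e)).
  { apply rsum_le_const. intro i. specialize (H i).
    apply Rabs_le_bounds in H. nra. }
  assert (INR n <= INR n * INR n).
  { destruct n as [|n]; [simpl; lra|]. rewrite S_INR in *.
    pose proof (pos_INR n); nra. }
  assert (0 <= e * e) by nra. nra.
Qed.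

Lemma dist_vnorm n x y : dist n x y = vnorm n (vadd x (vscale (-1) y)).
Proof. unfold dist; f_equal; vext; ring. Qed.

Lemma dist_sym n x y : dist n x y = dist n y x.
Proof.
  rewrite !dist_vnorm.
  replace (vadd y (vscale (-1) x)) with (vscale (-1) (vadd x (vscale (-1) y)))
    by (vext; ring).
  rewrite vnorm_scale, Rabs_m1; ring.
Qed.

Lemma dist_triangle n x y z : dist n x z <= dist n x y + dist n y z.
Proof.
  rewrite !dist_vnorm.
  replace (vadd x (vscale (-1) z))
    with (vadd (vadd x (vscale (-1) y)) (vadd y (vscale (-1) z)))
    by (vext; ring).
  apply vnorm_triangle.
Qed.

Lemma dist_refl n x : dist n x x = 0.
Proof.
  rewrite dist_vnorm. replace (vadd x (vscale (-1) x)) with (vscale 0 x)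
    by (vext; ring).
  rewrite vnorm_scale, Rabs_R0; ring.
Qed.

Lemma dist_le_vnorms n x y : dist n x y <= vnorm n x + vnorm n y.
Proof.
  rewrite dist_vnorm. eapply Rle_trans; [apply vnorm_triangle|].
  rewrite vnorm_scale, Rabs_m1; lra.
Qed.

Lemma vnorm_le_dist n x y : vnorm n x <= vnorm n y + dist n x y.
Proof.
  rewrite dist_vnorm.
  replace x with (vadd y (vadd x (vscale (-1) y))) at 1 by (vext; ring).
  apply vnorm_triangle.
Qed.

Definition comb (t : R) (x y : point) : point :=
  vadd (vscale (1 - t) x) (vscale t y).

Lemma in_Rn_vadd n x y : in_Rn n x -> in_Rn n y -> in_Rn n (vadd x y).
Proof. intros Hx Hy i Hi; unfold vadd; rewrite Hx, Hy by easy; ring. Qed.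

Lemma in_Rn_vscale n c x : in_Rn n x -> in_Rn n (vscale c x).
Proof. intros Hx i Hi; unfold vscale; rewrite Hx by easy; ring. Qed.

Lemma in_Rn_comb n t x y : in_Rn n x -> in_Rn n y -> in_Rn n (comb t x y).
Proof. intros; apply in_Rn_vadd; now apply in_Rn_vscale. Qed.

Lemma dist_comb n t x y x' y' : 0 <= t <= 1 ->
  dist n (comb t x y) (comb t x' y') <= (1 - t) * dist n x x' + t * dist n y y'.
Proof.
  intro Ht. rewrite !dist_vnorm.
  replace (vadd (comb t x y) (vscale (-1) (comb t x' y')))
    with (vadd (vscale (1 - t) (vadd x (vscale (-1) x')))
               (vscale t (vadd y (vscale (-1) y'))))
    by (unfold comb; vext; ring).
  eapply Rle_trans; [apply vnorm_triangle|].
  rewrite !vnorm_scale, !Rabs_pos_eq by lra. lra.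
Qed.

Lemma dist_comb_l n t x y : 0 <= t -> dist n x (comb t x y) = t * dist n x y.
Proof.
  intro Ht. rewrite !dist_vnorm.
  replace (vadd x (vscale (-1) (comb t x y)))
    with (vscale t (vadd x (vscale (-1) y))) by (unfold comb; vext; ring).
  now rewrite vnorm_scale, Rabs_pos_eq.
Qed.

(** * Steiner symmetrization: chords, Minkowski combinations, norm bounds and balls *)

Lemma lub_approx E l e : is_lub E l -> 0 < e -> exists c, E c /\ l - e < c.
Proof.
  intros [_ H] He. apply NNPP; intro N.
  assert (l <= l - e); [|lra].
  apply H; intros c Hc. apply Rnot_lt_le; intro. apply N; eauto.
Qed.

(** Members of [E1] and [E2] come within e of the suprema, so the bound on members passes to the
    suprema up to e. *)
Lemma lub_combination E1 E2 l1 l2 t l :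
  is_lub E1 l1 -> is_lub E2 l2 -> 0 <= t <= 1 ->
  (forall c1 c2, E1 c1 -> E2 c2 -> (1 - t) * c1 + t * c2 <= l) ->
  (1 - t) * l1 + t * l2 <= l.
Proof.
  intros H1 H2 Ht H. apply le_epsilon; intros e He.
  destruct (lub_approx _ _ _ H1 He) as (c1 & Hc1 & L1).
  destruct (lub_approx _ _ _ H2 He) as (c2 & Hc2 & L2).
  specialize (H _ _ Hc1 Hc2). nra.
Qed.

(** For a unit vector u, the orthogonal projection of y onto u^perp. It is convertible to the base
    point [x] inside [steiner]. *)
Definition foot (n : nat) (u y : point) : point :=
  vadd y (vscale (- dot n y u) u).

Lemma unit_dot n u : unit_vector n u -> dot n u u = 1.
Proof. intros [_ H]. rewrite <- vnorm_sqr, H; ring. Qed.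

Lemma foot_in_Rn n u y : unit_vector n u -> in_Rn n y -> in_Rn n (foot n u y).
Proof. intros [Hu _] Hy; apply in_Rn_vadd; [|apply in_Rn_vscale]; easy. Qed.

Lemma foot_orth n u y : unit_vector n u -> dot n (foot n u y) u = 0.
Proof. intro Hu; unfold foot; dots; rewrite (unit_dot n u Hu); ring. Qed.

Lemma foot_idem n u y : unit_vector n u -> foot n u (foot n u y) = foot n u y.
Proof.
  intro Hu; unfold foot at 1; rewrite foot_orth by easy; vext; ring.
Qed.

Lemma foot_add n u y : vadd (foot n u y) (vscale (dot n y u) u) = y.
Proof. unfold foot; vext; ring. Qed.

Lemma foot_comb n u t x y :
  foot n u (comb t x y) = comb t (foot n u x) (foot n u y).
Proof. unfold foot, comb; dots; vext; ring. Qed.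

Lemma line_hits_bounded n u B x M : unit_vector n u ->
  (forall y, B y -> vnorm n y <= M) ->
  forall a, line_hits B x u a -> Rabs a <= M + vnorm n x.
Proof.
  intros [_ Hu] HM a Ha. apply HM in Ha.
  assert (E : vnorm n (vscale a u) = Rabs a) by (rewrite vnorm_scale, Hu; ring).
  rewrite <- E.
  replace (vscale a u) with (vadd (vadd x (vscale a u)) (vscale (-1) x))
    by (vext; ring).
  eapply Rle_trans; [apply vnorm_triangle|].
  rewrite (vnorm_scale n (-1)), Rabs_m1; lra.
Qed.

Lemma chord_lub_exists n u B x a : unit_vector n u -> bounded n B ->
  line_hits B x u a -> exists l, is_lub (chord_lengths B x u) l.
Proof.
  intros Hu [M HM] Ha.
  destruct (completeness (chord_lengths B x u)) as [l Hl]; [| |now exists l].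
  - exists (2 * (M + vnorm n x)). intros c (b & d & Hb & Hd & ->).
    apply (line_hits_bounded n u B x M Hu HM) in Hb, Hd.
    apply Rabs_le_bounds in Hb, Hd; lra.
  - exists 0, a, a; repeat split; auto; ring.
Qed.

(** Any two points of B on the line bound the chord length from below by b - a, so membership
    follows without computing the supremum. *)
Lemma steiner_intro n u B y a b : unit_vector n u -> bounded n B ->
  in_Rn n y -> line_hits B (foot n u y) u a -> line_hits B (foot n u y) u b ->
  2 * Rabs (dot n y u) <= b - a -> steiner n u B y.
Proof.
  intros Hu HB Hy Ha Hb H. split; [easy|]. split; [now exists a|].
  destruct (chord_lub_exists n u B _ a Hu HB Ha) as [l Hl].
  exists l; split; [easy|].
  assert (b - a <= l) by (apply (proj1 Hl); exists a, b; auto). lra.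
Qed.

(** The foot has height 0 over u^perp, so it lies in the symmetral as soon as its line meets B.
    Applied to a singleton, this carries the fixed point of a combination through one
    symmetrization. *)
Lemma steiner_foot n u B x : unit_vector n u -> bounded n B -> in_Rn n x ->
  B x -> steiner n u B (foot n u x).
Proof.
  intros Hu HB Hx HBx.
  assert (line_hits B (foot n u (foot n u x)) u (dot n x u)).
  { unfold line_hits. now rewrite foot_idem, foot_add. }
  apply steiner_intro with (dot n x u) (dot n x u); auto.
  - now apply foot_in_Rn.
  - rewrite foot_orth, Rabs_R0 by easy; lra.
Qed.

(** Feet and heights are linear in the point. Chords of [A1] and [A2] combine to chords of B over
    the combined foot, so (1-t) l1 + t l2 <= l; the heights, at most l1/2 and l2/2 in absolute
    value, combine in the same way. The case A1 = A2 = B gives preservation of convexity. *)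
Lemma steiner_combination n u A1 A2 B t : unit_vector n u -> bounded n B ->
  0 <= t <= 1 -> (forall x y, A1 x -> A2 y -> B (comb t x y)) ->
  forall x y, steiner n u A1 x -> steiner n u A2 y -> steiner n u B (comb t x y).
Proof.
  intros Hu HB Ht H x y (Hx & (a1 & Ha1) & l1 & L1 & T1)
    (Hy & (a2 & Ha2) & l2 & L2 & T2).
  change (line_hits A1 (foot n u x) u a1) in Ha1.
  change (line_hits A2 (foot n u y) u a2) in Ha2.
  assert (Hit : forall a b, line_hits A1 (foot n u x) u a ->
    line_hits A2 (foot n u y) u b ->
    line_hits B (foot n u (comb t x y)) u ((1 - t) * a + t * b)).
  { intros a b Ha Hb. unfold line_hits. rewrite foot_comb.
    replace (vadd _ _) with (comb t (vadd (foot n u x) (vscale a u))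
      (vadd (foot n u y) (vscale b u))) by (unfold comb; vext; ring).
    now apply H. }
  split; [now apply in_Rn_comb|]. split; [eexists; apply Hit; eassumption|].
  destruct (chord_lub_exists n u B _ _ Hu HB (Hit _ _ Ha1 Ha2)) as [l Hl].
  exists l; split; [exact Hl|].
  assert ((1 - t) * l1 + t * l2 <= l).
  { apply (lub_combination _ _ _ _ _ _ L1 L2 Ht).
    intros c1 c2 (p1 & q1 & Hp1 & Hq1 & ->) (p2 & q2 & Hp2 & Hq2 & ->).
    apply (proj1 Hl). exists ((1 - t) * p1 + t * p2), ((1 - t) * q1 + t * q2).
    repeat split; [now apply Hit|now apply Hit|ring]. }
  unfold comb; dots.
  apply Rabs_le_bounds in T1, T2. apply Rabs_le; split; nra.
Qed.

(** By Pythagoras, the points of B over a foot with squared norm p have heights in [-w, w], where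
    w^2 = M^2 - p. The chord has length at most 2w, so the centred chord stays within the same
    heights. *)
Lemma steiner_norm_bound n u B M : unit_vector n u ->
  (forall x, B x -> vnorm n x <= M) ->
  forall y, steiner n u B y -> vnorm n y <= M.
Proof.
  intros Hu HM y (Hy & (a & Ha) & l & L & T).
  change (line_hits B (foot n u y) u a) in Ha.
  change (is_lub (chord_lengths B (foot n u y) u) l) in L.
  pose proof (unit_dot n u Hu) as Huu. pose proof (foot_orth n u y Hu) as Ho.
  assert (Pyth : forall s, dot n (vadd (foot n u y) (vscale s u))
    (vadd (foot n u y) (vscale s u)) = dot n (foot n u y) (foot n u y) + s * s).
  { intro s; dots. rewrite (dot_comm n u), Ho, Huu; ring. }
  set (p := dot n (foot n u y) (foot n u y)) in *.
  assert (HM0 : 0 <= M) by (pose proof (HM _ Ha);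
    pose proof (vnorm_nonneg n (vadd (foot n u y) (vscale a u))); lra).
  assert (Hit : forall s, line_hits B (foot n u y) u s -> s * s <= M * M - p).
  { intros s Hs. apply HM in Hs. pose proof (Pyth s) as E.
    rewrite <- vnorm_sqr in E.
    pose proof (vnorm_nonneg n (vadd (foot n u y) (vscale s u))). nra. }
  assert (Hw : 0 <= M * M - p) by (pose proof (Hit a Ha); nra).
  set (w := sqrt (M * M - p)).
  assert (Hww : w * w = M * M - p) by now apply sqrt_sqrt.
  assert (Hw0 : 0 <= w) by apply sqrt_pos.
  assert (l <= 2 * w).
  { apply (proj2 L). intros c (s1 & s2 & H1 & H2 & ->).
    apply Hit in H1, H2. assert (- w <= s1) by nra. assert (s2 <= w) by nra. lra. }
  apply vnorm_le; [easy|]. rewrite <- (foot_add n u y), Pyth.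
  cbv zeta in T. apply Rabs_le_bounds in T.
  assert (dot n y u * dot n y u <= w * w) by nra. lra.
Qed.

Definition contains_ball (n : nat) (c : point) (r : R) (A : rset) : Prop :=
  in_Rn n c /\ forall y, in_Rn n y -> dist n c y <= r -> A y.

(** The points over the foot of y at heights <c,u> + <y,u> and <c,u> - <y,u> are as far from c as y
    is from the foot of c. Both lie in A, so the chord has length at least 2|<y,u>|. *)
Lemma steiner_ball n u A c r : unit_vector n u -> bounded n A ->
  contains_ball n c r A -> contains_ball n (foot n u c) r (steiner n u A).
Proof.
  intros Hu HA [Hc H]. split; [now apply foot_in_Rn|]. intros y Hy Hd.
  pose proof (unit_dot n u Hu) as Huu. pose proof (foot_orth n u y Hu) as Ho.
  pose proof (foot_orth n u c Hu) as Hoc.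
  assert (Hit : forall s, s * s = dot n y u * dot n y u ->
    line_hits A (foot n u y) u (dot n c u + s)).
  { intros s Hs. apply H.
    - apply in_Rn_vadd; [now apply foot_in_Rn|]. apply in_Rn_vscale, Hu.
    - eapply Rle_trans; [|apply Hd]. apply Req_le. rewrite !dist_vnorm.
      unfold vnorm. f_equal.
      replace (vadd c (vscale (-1) (vadd (foot n u y)
        (vscale (dot n c u + s) u)))) with
        (vadd (vadd (foot n u c) (vscale (-1) (foot n u y))) (vscale (- s) u))
        by (unfold foot; vext; ring).
      replace (vadd (foot n u c) (vscale (-1) y)) with
        (vadd (vadd (foot n u c) (vscale (-1) (foot n u y)))
          (vscale (- dot n y u) u)) by (unfold foot; vext; ring).
      (* Both differences are z plus a multiple of u with z orthogonal to u, and the two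
         coefficients have equal squares. *)
      set (z := vadd (foot n u c) (vscale (-1) (foot n u y))).
      assert (Hz : dot n z u = 0) by (unfold z; dots; rewrite Ho, Hoc; ring).
      dots. rewrite (dot_comm n u z), Hz, Huu. lra. }
  apply steiner_intro with (dot n c u + - Rabs (dot n y u))
    (dot n c u + Rabs (dot n y u)); auto.
  - apply Hit. rewrite Rmult_opp_opp. symmetry; apply Rsqr_abs.
  - apply Hit. symmetry; apply Rsqr_abs.
  - lra.
Qed.

(** * One-sided Hausdorff bounds *)

(** One half of the bound d on the Hausdorff distance. The two directions are kept apart because
    each one is carried along the processes by its own combination. *)
Definition near (n : nat) (d : R) (A B : rset) : Prop :=
  forall x, A x -> exists y, B y /\ dist n x y <= d.

Lemma hausdorff_converges_near n Ks L : hausdorff_converges n Ks L ->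
  forall eps, 0 < eps -> exists N, forall i, (N <= i)%nat ->
    near n eps (Ks i) L /\ near n eps L (Ks i).
Proof.
  intros [_ H] eps He. destruct (H eps He) as [N HN]. exists N; intros i Hi.
  destruct (HN i Hi) as [H1 H2]. split; [exact H1|].
  intros y Hy. destruct (H2 y Hy) as (x & Hx & Hd).
  exists x; now rewrite dist_sym.
Qed.

Lemma near_trans n d e A B C :
  near n d A B -> near n e B C -> near n (d + e) A C.
Proof.
  intros H1 H2 x Hx. destruct (H1 x Hx) as (y & Hy & Dy).
  destruct (H2 y Hy) as (z & Hz & Dz). exists z; split; [easy|].
  pose proof (dist_triangle n x y z); lra.
Qed.

Lemma near_mono n d e A B : d <= e -> near n d A B -> near n e A B.
Proof.
  intros Hde H x Hx. destruct (H x Hx) as (y & Hy & D).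
  exists y; split; [easy|lra].
Qed.

(** * Blaschke selection: diagonal subsequences, finite nets and completeness *)

(** The recursion runs over the sigma type [{a | P i a}], so the invariant needed for the next
    choice travels with the value. *)
Lemma dependent_choice (A : Type) (P : nat -> A -> Prop)
  (Rel : nat -> A -> A -> Prop) (a0 : A) : P 0%nat a0 ->
  (forall i a, P i a -> exists b, P (S i) b /\ Rel i a b) ->
  exists f, f 0%nat = a0 /\ forall i, P i (f i) /\ Rel i (f i) (f (S i)).
Proof.
  intros H0 H.
  set (step := fun i (a : {a | P i a}) =>
    constructive_indefinite_description _ (H i (proj1_sig a) (proj2_sig a))).
  set (f := nat_rect (fun i => {a | P i a}) (exist _ a0 H0)
    (fun i a => exist _ (proj1_sig (step i a)) (proj1 (proj2_sig (step i a))))).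
  exists (fun i => proj1_sig (f i)). split; [easy|]. intro i; split.
  - apply proj2_sig.
  - exact (proj2 (proj2_sig (step i (f i)))).
Qed.

Definition infinite (S : nat -> Prop) : Prop :=
  forall N, exists i, (N <= i)%nat /\ S i.

Lemma infinite_split S T : infinite S ->
  infinite (fun i => S i /\ T i) \/ infinite (fun i => S i /\ ~ T i).
Proof.
  intro H. destruct (classic (infinite (fun i => S i /\ T i))) as [|N1]; [auto|].
  right. intro N. apply not_all_ex_not in N1. destruct N1 as [N1 H1].
  destruct (H (max N N1)) as (i & Hi & Si). exists i. split; [lia|].
  split; [easy|]. intro Ti. apply H1. exists i. split; [lia|easy].
Qed.

(** Split the index set by [T q] for one q of the list at a time and keep an infinite half; each
    [T q] is then constant on what remains. *)
Lemma infinite_pigeonhole (A : Type) (T : A -> nat -> Prop) (l : list A) S :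
  infinite S -> exists S', infinite S' /\ (forall i, S' i -> S i) /\
    forall q, In q l -> forall i j, S' i -> S' j -> T q i -> T q j.
Proof.
  revert S; induction l as [|q l IH]; intros S HS.
  - exists S; repeat split; auto. intros q [].
  - destruct (infinite_split S (T q) HS) as [H|H];
      destruct (IH _ H) as (S' & Inf & Sub & Cst); exists S'; repeat split; auto;
      try (intros i Hi; apply (Sub i Hi));
      intros p [<-|Hp] i j Hi Hj; eauto.
    + intros _; apply (Sub j Hj).
    + intro Ti; exfalso; now apply (Sub i Hi).
Qed.

(** Choose nested infinite sets [F k] on which [Rel k] holds, then increasing [phi i] in [F i]. For
    i >= k, nesting puts [phi i] in [F k]. *)
Lemma diagonal_subsequence (Rel : nat -> nat -> nat -> Prop) :
  (forall k S, infinite S -> exists S', infinite S' /\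
    (forall i, S' i -> S i) /\ forall i j, S' i -> S' j -> Rel k i j) ->
  exists phi : nat -> nat, (forall i, (phi i < phi (S i))%nat) /\
    forall k i j, (k <= i)%nat -> (k <= j)%nat -> Rel k (phi i) (phi j).
Proof.
  intro H.
  assert (H0 : infinite (fun _ => True)) by (intro N; exists N; auto).
  destruct (H 0%nat _ H0) as (S0 & I0 & _ & R0).
  destruct (dependent_choice (nat -> Prop)
    (fun k S => infinite S /\ forall i j, S i -> S j -> Rel k i j)
    (fun _ S S' => forall i, S' i -> S i) S0) as (F & _ & HF); [auto| |].
  { intros k S [HS _]. destruct (H (Datatypes.S k) S HS) as (S' & ? & ? & ?).
    exists S'; auto. }
  assert (Anti : forall k d i, F (k + d)%nat i -> F k i).
  { intros k d; induction d as [|d IH]; intro i.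
    - now rewrite Nat.add_0_r.
    - rewrite Nat.add_succ_r. intro Hi. apply IH. now apply HF. }
  destruct (proj1 (proj1 (HF 0%nat)) 0%nat) as (p0 & _ & Hp0).
  destruct (dependent_choice nat F (fun _ a b => (a < b)%nat) p0 Hp0)
    as (phi & _ & Hphi).
  { intros k a _. destruct (proj1 (proj1 (HF (S k))) (S a)) as (b & Hb & Fb).
    exists b; auto. }
  exists phi. split; [intro i; apply Hphi|]. intros k i j Hi Hj.
  apply HF.
  - apply (Anti k (i - k)%nat). replace (k + (i - k))%nat with i by lia. apply Hphi.
  - apply (Anti k (j - k)%nat). replace (k + (j - k))%nat with j by lia. apply Hphi.
Qed.

Lemma interval_net M e : 0 < e ->
  exists l, forall s, Rabs s <= M -> exists q, In q l /\ Rabs (s - q) <= e.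
Proof.
  intro He.
  assert (H : forall N, exists l, forall s, - M <= s <= - M + INR N * e ->
    exists q, In q l /\ Rabs (s - q) <= e).
  { induction N as [|N [l Hl]].
    - exists (- M :: nil). intros s Hs. exists (- M). simpl in *.
      split; [auto|]. apply Rabs_le; lra.
    - exists ((- M + INR (S N) * e) :: l). intros s Hs.
      destruct (Rle_lt_dec s (- M + INR N * e)) as [L|L].
      + destruct (Hl s) as (q & Hq & D); [lra|]. exists q; simpl; auto.
      + exists (- M + INR (S N) * e). split; [simpl; auto|].
        rewrite S_INR in *. apply Rabs_le; lra. }
  destruct (INR_unbounded (2 * M / e)) as [N HN].
  destruct (H N) as [l Hl]. exists l. intros s Hs. apply Hl.
  apply Rabs_le_bounds in Hs.
  assert (2 * M <= INR N * e); [|lra].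
  replace (2 * M) with (2 * M / e * e) by (field; lra). nra.
Qed.

Lemma cube_net n M e : 0 < e ->
  exists l, forall x, in_Rn n x -> (forall i, Rabs (x i) <= M) ->
    exists q, In q l /\ forall i, Rabs (x i - q i) <= e.
Proof.
  intro He. destruct (interval_net M e He) as [l1 H1].
  induction n as [|n [l Hl]].
  - exists ((fun _ => 0) :: nil). intros x Hx _. exists (fun _ => 0).
    split; [simpl; auto|]. intro i. rewrite Hx by lia.
    rewrite Rminus_diag, Rabs_R0; lra.
  - exists (map (fun rp i => if Nat.eq_dec i n then fst rp else snd rp i)
      (list_prod l1 l)).
    intros x Hx HM. destruct (H1 (x n) (HM n)) as (r & Hr & Dr).
    (* Zeroing coordinate n puts x in the lower-dimensional space, where the induction hypothesis
       supplies a net point. *)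
    destruct (Hl (fun i => if Nat.eq_dec i n then 0 else x i)) as (p & Hp & Dp).
    + intros i Hi. destruct (Nat.eq_dec i n); [easy|apply Hx; lia].
    + intro i. specialize (HM i). pose proof (Rabs_pos (x i)).
      destruct (Nat.eq_dec i n); [rewrite Rabs_R0; lra|easy].
    + exists (fun i => if Nat.eq_dec i n then r else p i). split.
      * apply in_map_iff. exists (r, p). split; [easy|]. now apply in_prod.
      * intro i. specialize (Dp i).
        destruct (Nat.eq_dec i n) as [->|]; easy.
Qed.

Lemma ball_net n M d : 0 < d ->
  exists l, forall x, in_Rn n x -> vnorm n x <= M ->
    exists q, In q l /\ dist n x q <= d.
Proof.
  intro Hd. pose proof (pos_INR n) as Hn.
  (* The summand 1 keeps the denominator positive in dimension 0. *)
  assert (He : 0 < d / (INR n + 1)) by (apply Rdiv_lt_0_compat; lra).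
  destruct (cube_net n M _ He) as [l Hl]. exists l. intros x Hx HM.
  destruct (Hl x Hx) as (q & Hq & D).
  { intro i. pose proof (coord_le_vnorm n x i Hx). lra. }
  exists q. split; [easy|].
  eapply Rle_trans; [apply vnorm_le_sup; [|exact D]; lra|].
  replace d with ((INR n + 1) * (d / (INR n + 1))) at 2 by (field; lra). nra.
Qed.

(** Take a finite d/2-net of the ball of radius M and keep infinitely many indices whose sets come
    within d/2 of exactly the same net points. A point of one such set then reaches any other set
    through a net point. *)
Lemma near_refinement n (Ks : nat -> rset) M d S : 0 < d ->
  (forall i x, Ks i x -> in_Rn n x /\ vnorm n x <= M) -> infinite S ->
  exists S', infinite S' /\ (forall i, S' i -> S i) /\
    forall i j, S' i -> S' j -> near n d (Ks i) (Ks j).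
Proof.
  intros Hd HK HS. destruct (ball_net n M (d / 2)) as [l Hl]; [lra|].
  destruct (infinite_pigeonhole point
    (fun q i => exists x, Ks i x /\ dist n x q <= d / 2) l S HS)
    as (S' & Inf & Sub & Cst).
  exists S'. repeat split; auto. intros i j Hi Hj x Hx.
  destruct (HK i x Hx) as [Rx Mx]. destruct (Hl x Rx Mx) as (q & Hq & D).
  destruct (Cst q Hq i j Hi Hj) as (y & Hy & Dy); [now exists x|].
  exists y. split; [easy|]. pose proof (dist_triangle n x q y).
  rewrite (dist_sym n q y) in *. lra.
Qed.

(** Completeness of R^n with a rate: x is the coordinatewise limit, and the bound [e m] survives the
    passage j -> infinity. *)
Lemma cauchy_limit n (y : nat -> point) (e : nat -> R) :
  (forall m, in_Rn n (y m)) -> Un_cv e 0 ->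
  (forall m j, dist n (y m) (y (m + j)%nat) <= e m) ->
  exists x, in_Rn n x /\ forall m, dist n (y m) x <= e m.
Proof.
  intros Hy He H.
  assert (He0 : forall m, 0 <= e m).
  { intro m. pose proof (H m 0%nat). pose proof (vnorm_nonneg n
      (fun i => y m i - y (m + 0)%nat i)). unfold dist in *. lra. }
  assert (C : forall i, Cauchy_crit (fun m => y m i)).
  { intros i eps Heps. destruct (He (eps / 2)) as [N HN]; [lra|].
    assert (B : forall m, (m >= N)%nat -> Rabs (y N i - y m i) < eps / 2).
    { intros m Hm. specialize (HN N (le_n N)). unfold Rdist in HN.
      rewrite Rminus_0_r in HN. specialize (H N (m - N)%nat).
      replace (N + (m - N))%nat with m in H by lia.
      assert (V : in_Rn n (fun i => y N i - y m i)).
      { intros k Hk. rewrite !Hy by easy. ring. }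
      pose proof (coord_le_vnorm n _ i V) as B.
      fold (dist n (y N) (y m)) in B. pose proof (Rle_abs (e N)).
      simpl in B. lra. }
    exists N. intros p q Hp Hq. pose proof (B p Hp) as Bp. pose proof (B q Hq) as Bq.
    unfold Rdist. replace (y p i - y q i)
      with (- (y N i - y p i) + (y N i - y q i)) by ring.
    eapply Rle_lt_trans; [apply Rabs_triang|]. rewrite Rabs_Ropp. lra. }
  exists (fun i => proj1_sig (R_complete _ (C i))).
  assert (L : forall i, Un_cv (fun m => y m i) (proj1_sig (R_complete _ (C i))))
    by (intro i; apply proj2_sig).
  set (x := fun i => proj1_sig (R_complete _ (C i))) in *.
  split.
  - intros i Hi. apply (UL_sequence (fun m => y m i)); [apply L|].
    intros eps Heps. exists 0%nat. intros m _. rewrite Hy by easy.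
    unfold Rdist. now rewrite Rminus_diag, Rabs_R0.
  - intro m. apply vnorm_le; [apply He0|].
    (* Squared distances are finite sums of products, so only limits of sums and products are
       taken. *)
    apply (Rle_cv_lim (Un := fun j => dot n (fun i => y m i - y (m + j)%nat i)
      (fun i => y m i - y (m + j)%nat i)) (Vn := fun _ => e m * e m)).
    + intro j. rewrite <- vnorm_sqr. fold (dist n (y m) (y (m + j)%nat)).
      specialize (H m j). pose proof (vnorm_nonneg n
        (fun i => y m i - y (m + j)%nat i)).
      fold (dist n (y m) (y (m + j)%nat)) in *. nra.
    + unfold dot. apply (rsum_cv n (fun j i => (y m i - y (m + j)%nat i) *
        (y m i - y (m + j)%nat i))). intro i.
      assert (Cm : Un_cv (fun j => y m i - y (m + j)%nat i) (y m i - x i)).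
      { intros eps Heps. destruct (L i eps Heps) as [N HN]. exists N.
        intros j Hj. specialize (HN (m + j)%nat ltac:(lia)). unfold Rdist in *.
        rewrite <- Rabs_Ropp. fold (x i) in HN.
        replace (- (y m i - y (m + j)%nat i - (y m i - x i)))
          with (y (m + j)%nat i - x i) by ring. easy. }
      now apply (CV_mult _ _ _ _ Cm).
    + intros eps Heps. exists 0%nat. intros. unfold Rdist.
      now rewrite Rminus_diag, Rabs_R0.
Qed.

Lemma half_pow_pos k : 0 < (1 / 2) ^ k.
Proof. apply pow_lt; lra. Qed.

Lemma half_pow_small e : 0 < e ->
  exists N, forall i, (N <= i)%nat -> (1 / 2) ^ i < e.
Proof.
  intro He. destruct (pow_lt_1_zero (1 / 2)) with e as [N HN]; [|easy|].
  - rewrite Rabs_pos_eq; lra.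
  - exists N. intros i Hi. specialize (HN i Hi).
    pose proof (Rle_abs ((1 / 2) ^ i)). lra.
Qed.

(** Starting from y, choose a point in each later set at distance at most (1/2)^(k+m) from the
    previous one. The geometric series bounds the total displacement by 2 (1/2)^k. *)
Lemma near_chain_limit n (A : nat -> rset) k y :
  (forall i x, A i x -> in_Rn n x) ->
  (forall i j k, (k <= i)%nat -> (k <= j)%nat ->
    near n ((1 / 2) ^ k) (A i) (A j)) ->
  A k y -> exists x, in_Rn n x /\ dist n y x <= 2 * (1 / 2) ^ k /\
    forall eps, 0 < eps -> exists N, forall i, (N <= i)%nat ->
      exists z, A i z /\ dist n x z <= eps.
Proof.
  intros HA HN Hy.
  destruct (dependent_choice point (fun m p => A (k + m)%nat p)
    (fun m p q => dist n p q <= (1 / 2) ^ (k + m)) y) as (f & f0 & Hf).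
  - now rewrite Nat.add_0_r.
  - intros m p Hp. apply (HN (k + m)%nat (k + S m)%nat (k + m)%nat); auto; lia.
  - destruct (cauchy_limit n f (fun m => 2 * (1 / 2) ^ (k + m)))
      as (x & Hx & Dx).
    + intro m. apply (HA _ _ (proj1 (Hf m))).
    + intros e He. destruct (half_pow_small (e / 2)) as [N H]; [lra|].
      exists N. intros m Hm. specialize (H (k + m)%nat ltac:(lia)).
      pose proof (half_pow_pos (k + m)). unfold Rdist.
      rewrite Rminus_0_r, Rabs_pos_eq; lra.
    + intros m j.
      (* Keeping the remaining tail of the geometric series in the bound makes the induction on j
         close. *)
      assert (dist n (f m) (f (m + j)%nat) <=
        2 * (1 / 2) ^ (k + m) - 2 * (1 / 2) ^ (k + m + j)).
      { induction j as [|j IH].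
        - rewrite !Nat.add_0_r, dist_refl. lra.
        - rewrite !Nat.add_succ_r. pose proof (proj2 (Hf (m + j)%nat)) as D.
          pose proof (dist_triangle n (f m) (f (m + j)%nat) (f (S (m + j)))).
          rewrite Nat.add_assoc in D. simpl. lra. }
      pose proof (half_pow_pos (k + m + j)). lra.
    + exists x. split; [easy|]. split.
      * specialize (Dx 0%nat). now rewrite f0, Nat.add_0_r in Dx.
      * intros e He. destruct (half_pow_small (e / 2)) as [N H]; [lra|].
        exists (k + N)%nat. intros i Hi. exists (f (i - k)%nat). split.
        -- replace i with (k + (i - k))%nat at 1 by lia. apply Hf.
        -- rewrite dist_sym. specialize (Dx (i - k)%nat).
           replace (k + (i - k))%nat with i in Dx by lia.
           specialize (H i ltac:(lia)). lra.
Qed.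

(** Refining at scale (1/2)^k for every k and passing to the diagonal makes the sets Cauchy in the
    Hausdorff metric; the limit is then built from limits of chains of points. *)
Lemma blaschke_selection n (Ks : nat -> rset) M :
  (forall i x, Ks i x -> in_Rn n x /\ vnorm n x <= M) ->
  (forall i, exists x, Ks i x) -> (forall i, convex (Ks i)) ->
  exists phi L, (forall i, (phi i < phi (S i))%nat) /\
    hausdorff_converges n (fun i => Ks (phi i)) L.
Proof.
  intros HK HE HC.
  destruct (diagonal_subsequence
    (fun k i j => near n ((1 / 2) ^ k) (Ks i) (Ks j))) as (phi & Hphi & HN).
  { intros k S HS. apply (near_refinement n Ks M); auto. apply half_pow_pos. }
  set (A := fun i => Ks (phi i)).
  (* The lower limit of the sets: the points approximated by all late sets. *)
  set (L := fun x => in_Rn n x /\ forall eps, 0 < eps ->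
    exists N, forall i, (N <= i)%nat -> exists z, A i z /\ dist n x z <= eps).
  assert (HL : forall k y, A k y -> exists x, L x /\ dist n y x <= 2 * (1 / 2) ^ k).
  { intros k y Hy. destruct (near_chain_limit n A k y) as (x & Hx & D & Lx); auto.
    - intros i x Hx; apply (HK _ _ Hx).
    - intros i j k' Hi Hj. now apply HN.
    - exists x. split; [split|]; auto. }
  exists phi, L. split; [easy|]. split.
  - split; [now intros x [Hx _]|]. split.
    { destruct (HE (phi 0%nat)) as [y Hy]. destruct (HL 0%nat y Hy) as (x & Hx & _).
      now exists x. }
    split; [|split].
    + intros x y t [Hx Lx] [Hy Ly] Ht. split; [now apply in_Rn_comb|].
      intros e He. destruct (Lx e He) as [N1 H1]. destruct (Ly e He) as [N2 H2].
      exists (max N1 N2). intros i Hi.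
      destruct (H1 i ltac:(lia)) as (x' & Ax & Dx).
      destruct (H2 i ltac:(lia)) as (y' & Ay & Dy).
      exists (comb t x' y'). split; [now apply HC|].
      eapply Rle_trans; [apply (dist_comb n t x y x' y' Ht)|]. nra.
    + exists (M + 1). intros x [Hx Lx]. destruct (Lx 1) as [N HN1]; [lra|].
      destruct (HN1 N (le_n N)) as (z & Az & Dz).
      pose proof (vnorm_le_dist n x z). pose proof (proj2 (HK _ _ Az)). lra.
    + intros x Hx H. split; [easy|]. intros e He.
      destruct (H (e / 2)) as (y & [_ Ly] & D); [lra|].
      destruct (Ly (e / 2)) as [N H1]; [lra|]. exists N. intros i Hi.
      destruct (H1 i Hi) as (z & Az & Dz). exists z. split; [easy|].
      pose proof (dist_triangle n x y z). lra.
  - intros e He. destruct (half_pow_small (e / 2)) as [N H]; [lra|].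
    exists N. intros i Hi. specialize (H i Hi). split.
    + intros y Hy. destruct (HL i y Hy) as (x & Hx & D).
      exists x. split; [easy|lra].
    + intros x [Hx Lx]. destruct (Lx (e / 2)) as [N' H']; [lra|].
      (* How late the sets must be to approximate x depends on x, so approximate in a late set and
         return to the set of index i at cost (1/2)^i; this makes the bound uniform in x. *)
      destruct (H' (max i N')) as (z & Az & Dz); [lia|].
      destruct (HN i (max i N') i ltac:(lia) ltac:(lia) z Az) as (w & Aw & Dw).
      exists w. split; [exact Aw|]. rewrite dist_sym.
      pose proof (dist_triangle n x z w). lra.
Qed.

(** * Balls and Minkowski combinations under Hausdorff closeness *)

(* Radstrom cancellation: if a = l + v/m with l in L and |v| <= d, write
   a + v = l' + v' with l' in L and |v'| <= d; then
   a = (m l + l')/(m+1) + v'/(m+1).  Let m tend to infinity. *)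
Lemma ball_cancellation n A L c r d : 0 <= d ->
  contains_ball n c r A -> near n d A L -> (forall x, L x -> in_Rn n x) ->
  convex L -> closed n L -> contains_ball n c (r - d) L.
Proof.
  intros Hd [Hc HA] HN HR HC HL. split; [easy|]. intros a Ha Da.
  assert (Hit : forall v, in_Rn n v -> vnorm n v <= d ->
    exists l, L l /\ vnorm n (vadd (vadd a v) (vscale (-1) l)) <= d).
  { intros v Hv Dv. destruct (HN (vadd a v)) as (l & Ll & Dl).
    - apply HA; [now apply in_Rn_vadd|].
      assert (E : dist n a (vadd a v) = vnorm n v).
      { rewrite dist_sym, dist_vnorm. f_equal. vext; ring. }
      pose proof (dist_triangle n c a (vadd a v)). lra.
    - exists l. now rewrite <- dist_vnorm. }
  assert (Mean : forall m, exists l v, L l /\ in_Rn n v /\ vnorm n v <= d /\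
    vadd a (vscale (-1) l) = vscale (/ INR (S m)) v).
  { induction m as [|m (l & v & Ll & Hv & Dv & E)].
    - destruct (Hit (vscale 0 a)) as (l & Ll & Dl).
      { now apply in_Rn_vscale. }
      { rewrite vnorm_scale, Rabs_R0; lra. }
      exists l, (vadd (vadd a (vscale 0 a)) (vscale (-1) l)).
      repeat split; auto.
      + apply in_Rn_vadd; [apply in_Rn_vadd|]; try apply in_Rn_vscale; auto.
      + simpl; vext; field.
    - destruct (Hit v Hv Dv) as (l' & Ll' & Dl').
      exists (comb (/ INR (S (S m))) l l'),
        (vadd (vadd a v) (vscale (-1) l')).
      assert (P : 0 < INR (S m)) by (apply lt_0_INR; lia).
      rewrite (S_INR (S m)). repeat split; auto.
      + apply HC; auto. split; [left; apply Rinv_0_lt_compat; lra|].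
        rewrite <- Rinv_1. apply Rinv_le_contravar; lra.
      + apply in_Rn_vadd; [apply in_Rn_vadd|]; try apply in_Rn_vscale; auto.
      + apply functional_extensionality; intro i.
        assert (Ei := f_equal (fun f => f i) E). unfold comb, vadd, vscale in *.
        cbv beta in Ei.
        assert (v i = INR (S m) * (a i + -1 * l i)) as ->
          by (rewrite Ei; field; lra).
        field; lra. }
  apply HL; [easy|]. intros eps Heps.
  destruct (INR_unbounded (d / eps)) as [m Hm].
  destruct (Mean m) as (l & v & Ll & Hv & Dv & E). exists l. split; [easy|].
  rewrite dist_vnorm, E, vnorm_scale.
  assert (P : 0 < INR (S m)) by (apply lt_0_INR; lia).
  rewrite Rabs_pos_eq by (left; now apply Rinv_0_lt_compat).
  apply Rmult_lt_reg_l with (INR (S m)); [easy|].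
  rewrite <- Rmult_assoc, Rinv_r by lra.
  assert (d < INR m * eps).
  { replace d with (d / eps * eps) by (field; lra). nra. }
  rewrite S_INR in *. nra.
Qed.

(** Write x = y + w with y in B and |w| <= d. Then (1-t)x + tc = (1-t)y + t(c + ((1-t)/t) w), and
    the last point lies in the ball about c because (1-t)d <= t r. *)
Lemma near_comb n A B c r d t : (forall x, A x -> in_Rn n x) ->
  (forall x, B x -> in_Rn n x) -> convex B ->
  near n d A B -> contains_ball n c r B -> 0 < t <= 1 -> d <= t * r ->
  forall x, A x -> B (comb t x c).
Proof.
  intros HA HB HC HN [Hc Hball] Ht Hd x Hx.
  destruct (HN x Hx) as (y & Hy & D).
  pose (w := vadd x (vscale (-1) y)).
  replace (comb t x c) with (comb t y (vadd c (vscale ((1 - t) / t) w)))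
    by (unfold comb, w; vext; field; lra).
  apply HC; [easy| |lra]. apply Hball.
  - apply in_Rn_vadd; [easy|]. apply in_Rn_vscale, in_Rn_vadd; auto.
    apply in_Rn_vscale; auto.
  - rewrite dist_sym, dist_vnorm.
    replace (vadd (vadd c (vscale ((1 - t) / t) w)) (vscale (-1) c))
      with (vscale ((1 - t) / t) w) by (vext; ring).
    assert (Q : 0 <= (1 - t) / t)
      by (apply Rmult_le_pos; [|left; apply Rinv_0_lt_compat]; lra).
    rewrite vnorm_scale, Rabs_pos_eq by easy. unfold w. rewrite <- dist_vnorm.
    pose proof (vnorm_nonneg n (fun i => x i - y i)) as Hp.
    fold (dist n x y) in Hp.
    apply Rmult_le_reg_l with t; [lra|].
    replace (t * ((1 - t) / t * dist n x y)) with ((1 - t) * dist n x y)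
      by (field; lra). nra.
Qed.

(** * Properties carried along a Steiner process *)

(** For unit directions, this is the Steiner process of the singleton of c, followed as a point. *)
Fixpoint foot_process (n : nat) (alpha : nat -> point) (c : point) (i : nat)
  : point :=
  match i with
  | O => c
  | S j => foot n (alpha j) (foot_process n alpha c j)
  end.

Lemma process_in_Rn n alpha K i : (forall x, K x -> in_Rn n x) ->
  forall x, steiner_process n alpha K i x -> in_Rn n x.
Proof. intro HK; destruct i as [|i]; simpl; [auto|]. now intros x [Hx _]. Qed.

Lemma process_norm_bound n alpha
  (Hu : forall i, unit_vector n (alpha i)) K M i :
  (forall x, K x -> vnorm n x <= M) ->
  forall x, steiner_process n alpha K i x -> vnorm n x <= M.
Proof.
  intro HM; induction i as [|i IH]; simpl; [auto|].
  now apply steiner_norm_bound.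
Qed.

Lemma process_bounded n alpha
  (Hu : forall i, unit_vector n (alpha i)) K i :
  bounded n K -> bounded n (steiner_process n alpha K i).
Proof. intros [M HM]; exists M; now apply process_norm_bound. Qed.

Lemma process_convex n alpha
  (Hu : forall i, unit_vector n (alpha i)) K i :
  bounded n K -> convex K -> convex (steiner_process n alpha K i).
Proof.
  intros HB HK; induction i as [|i IH]; simpl; [easy|].
  intros x y t Hx Hy Ht.
  apply (steiner_combination n (alpha i) (steiner_process n alpha K i)
    (steiner_process n alpha K i)); auto.
  - now apply process_bounded.
  - intros; now apply IH.
Qed.

Lemma process_ball n alpha
  (Hu : forall i, unit_vector n (alpha i)) K c r i :
  bounded n K -> contains_ball n c r K ->
  contains_ball n (foot_process n alpha c i) r (steiner_process n alpha K i).
Proof.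
  intros HB HK; induction i as [|i IH]; simpl; [easy|].
  apply steiner_ball; auto. now apply process_bounded.
Qed.

(** Each step applies [steiner_combination] with the singleton of the current projected centre as
    second set. *)
Lemma process_comb n alpha
  (Hu : forall i, unit_vector n (alpha i)) A B c t j :
  bounded n B -> in_Rn n c -> 0 <= t <= 1 ->
  (forall x, steiner_process n alpha A j x ->
    steiner_process n alpha B j (comb t x (foot_process n alpha c j))) ->
  forall k, (j <= k)%nat -> forall x, steiner_process n alpha A k x ->
    steiner_process n alpha B k (comb t x (foot_process n alpha c k)).
Proof.
  intros HB Hc Ht H k Hk. induction Hk as [|k Hk IH]; [easy|]. simpl.
  assert (Hf : forall i, in_Rn n (foot_process n alpha c i))
    by (induction i; [easy|now apply foot_in_Rn]).
  intros x Hx.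
  apply (steiner_combination n (alpha k) (steiner_process n alpha A k)
    (eq (foot_process n alpha c k))); auto.
  - now apply process_bounded.
  - intros y z Hy <-. now apply IH.
  - apply steiner_foot; auto. exists (vnorm n (foot_process n alpha c k)).
    intros y <-; lra.
Qed.

(** [near_comb] gives the inclusion at index j and [process_comb] carries it to k. The combination
    moves x by t times its distance to the centre, at most 2M, so the bound does not depend on k. *)
Lemma process_near n alpha
  (Hu : forall i, unit_vector n (alpha i)) A B c r d t M j :
  (forall x, A x -> in_Rn n x /\ vnorm n x <= M) ->
  (forall x, B x -> in_Rn n x /\ vnorm n x <= M) -> convex B ->
  contains_ball n c r B -> 0 <= r -> 0 < t <= 1 -> d <= t * r ->
  near n d (steiner_process n alpha A j) (steiner_process n alpha B j) ->
  forall k, (j <= k)%nat -> near n (2 * M * t)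
    (steiner_process n alpha A k) (steiner_process n alpha B k).
Proof.
  intros HA HB HC Hball Hr Ht Hd HN k Hk x Hx.
  assert (BB : bounded n B) by (exists M; intros y Hy; apply (HB y Hy)).
  assert (Hin : forall C, (forall y, C y -> in_Rn n y /\ vnorm n y <= M) ->
    forall i y, steiner_process n alpha C i y -> in_Rn n y /\ vnorm n y <= M).
  { intros C H i y Hy. split.
    - apply (process_in_Rn n alpha C i); [|easy]. intros z Hz; apply (H z Hz).
    - apply (process_norm_bound n alpha Hu C M i); [|easy].
      intros z Hz; apply (H z Hz). }
  exists (comb t x (foot_process n alpha c k)). split.
  - apply (process_comb n alpha Hu A B c t j); auto; [apply Hball|lra|].
    apply (near_comb n (steiner_process n alpha A j) _ _ r d); auto.
    + intros y Hy; apply (Hin A HA _ _ Hy).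
    + intros y Hy; apply (Hin B HB _ _ Hy).
    + now apply process_convex.
    + now apply process_ball.
  - rewrite dist_comb_l by lra.
    destruct (process_ball n alpha Hu B c r k BB Hball) as [Hc Hb].
    assert (Bc : steiner_process n alpha B k (foot_process n alpha c k))
      by (apply Hb; [easy|rewrite dist_refl; lra]).
    pose proof (proj2 (Hin A HA _ _ Hx)). pose proof (proj2 (Hin B HB _ _ Bc)).
    pose proof (dist_le_vnorms n x (foot_process n alpha c k)). nra.
Qed.

(** * Convergence of the process *)

Lemma subsequence_ge (phi : nat -> nat) :
  (forall i, (phi i < phi (S i))%nat) -> forall i, (i <= phi i)%nat.
Proof. intros H i; induction i; [lia|]. specialize (H i); lia. Qed.

Theorem theorem4p6 (n : nat) (K : rset) (alpha : nat -> point) :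
  compact_convex n K ->
  nonempty_interior n K ->
  (forall i, unit_vector n (alpha i)) ->
  (forall L, subsequential_limit n alpha K L -> steiner_limit_is n alpha L L) ->
  exists L, steiner_limit_is n alpha K L.
Proof.
  intros (KR & _ & KC & KB & _) (c & r0 & Hc & Hr0 & Hball) Hu Hlim.
  (* Halving the radius passes from the open ball of [nonempty_interior] to a closed ball. *)
  assert (BK : contains_ball n c (r0 / 2) K).
  { split; [easy|]. intros y Hy D. apply Hball; [easy|lra]. }
  destruct KB as [M1 HM1].
  assert (KB : bounded n K) by now exists M1.
  destruct (blaschke_selection n (steiner_process n alpha K) M1)
    as (phi & L & Hphi & HL).
  { intros i x Hx. split.
    - now apply (process_in_Rn n alpha K i).
    - now apply (process_norm_bound n alpha Hu K M1 i). }
  { intro i. destruct (process_ball n alpha Hu K c (r0 / 2) i KB BK) as [Hci Hb].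
    eexists; apply Hb; [exact Hci|]. rewrite dist_refl; lra. }
  { intro i; now apply process_convex. }
  exists L.
  assert (HLL : steiner_limit_is n alpha L L) by (apply Hlim; now exists phi).
  pose proof (hausdorff_converges_near _ _ _ HL) as NK.
  pose proof (hausdorff_converges_near _ _ _ HLL) as NL.
  destruct HL as [HLc _]. split; [easy|].
  destruct HLc as (LR & _ & LC & [M2 HM2] & Lcl).
  (* Some K_i within r of L contains a ball of radius r0/2, and cancellation leaves radius r0/2 - r
     = r0/4 for L. So r serves for both K and L. *)
  set (r := r0 / 4). assert (Hr : 0 < r) by (unfold r; lra).
  destruct (NK r Hr) as [N0 H0].
  set (c' := foot_process n alpha c (phi N0)).
  assert (BL : contains_ball n c' r L).
  { replace r with (r0 / 2 - r) by (unfold r; field).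
    apply ball_cancellation with (steiner_process n alpha K (phi N0)); auto.
    - lra.
    - now apply process_ball.
    - apply H0; lia. }
  assert (BK' : contains_ball n c r K).
  { split; [easy|]. intros y Hy D. apply BK; [easy|]. unfold r in *; lra. }
  set (M := Rabs M1 + Rabs M2 + 1).
  pose proof (Rle_abs M1). pose proof (Rle_abs M2).
  pose proof (Rabs_pos M1). pose proof (Rabs_pos M2).
  assert (MK : forall x, K x -> in_Rn n x /\ vnorm n x <= M).
  { intros x Hx. split; [auto|]. specialize (HM1 x Hx). unfold M; lra. }
  assert (ML : forall x, L x -> in_Rn n x /\ vnorm n x <= M).
  { intros x Hx. split; [auto|]. specialize (HM2 x Hx). unfold M; lra. }
  intros eps Heps.
  assert (HM : 1 <= M) by (unfold M; lra).
  (* Chosen so that the drift 2Mt between the processes is at most eps/2, leaving eps/2 for the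
     distance from L_k to L. *)
  set (t := Rmin 1 (eps / (4 * M))).
  assert (Ht : 0 < t <= 1).
  { split; [|apply Rmin_l]. apply Rmin_pos; [lra|]. apply Rdiv_lt_0_compat; lra. }
  assert (HtM : 2 * M * t <= eps / 2).
  { replace (eps / 2) with (2 * M * (eps / (4 * M))) by (field; lra).
    apply Rmult_le_compat_l; [lra|]. apply Rmin_r. }
  assert (Htr : 0 < t * r) by (apply Rmult_lt_0_compat; lra).
  destruct (NK (t * r / 2)) as [N1 C1]; [lra|].
  destruct (NL (t * r / 2)) as [N2 C2]; [lra|].
  destruct (NL (eps / 2)) as [N3 C3]; [lra|].
  (* The index j must be a late term of the subsequence, for K_j close to L, and at least [N2], for
     L_j close to L; [phi i >= i] gives both. The two errors t r/2 add up to the allowed t r. *)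
  pose proof (subsequence_ge phi Hphi (max N1 N2)) as Hj.
  destruct (C1 (max N1 N2) ltac:(lia)) as [K1 K2].
  destruct (C2 (phi (max N1 N2)) ltac:(lia)) as [L1 L2].
  set (j := phi (max N1 N2)) in *.
  assert (D1 : near n (t * r) (steiner_process n alpha K j)
    (steiner_process n alpha L j)).
  { replace (t * r) with (t * r / 2 + t * r / 2) by field.
    now apply near_trans with L. }
  assert (D2 : near n (t * r) (steiner_process n alpha L j)
    (steiner_process n alpha K j)).
  { replace (t * r) with (t * r / 2 + t * r / 2) by field.
    now apply near_trans with L. }
  exists (max j N3). intros k Hk.
  destruct (C3 k ltac:(lia)) as [L3 L4].
  assert (E1 : near n eps (steiner_process n alpha K k) L).
  { apply near_mono with (2 * M * t + eps / 2); [lra|].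
    apply near_trans with (steiner_process n alpha L k); [|easy].
    apply (process_near n alpha Hu K L c' r (t * r) t M j); auto; lra || lia. }
  assert (E2 : near n eps L (steiner_process n alpha K k)).
  { apply near_mono with (eps / 2 + 2 * M * t); [lra|].
    apply near_trans with (steiner_process n alpha L k); [easy|].
    apply (process_near n alpha Hu L K c r (t * r) t M j); auto; lra || lia. }
  split; [exact E1|]. intros y Hy. destruct (E2 y Hy) as (x & Hx & D).
  exists x. now rewrite dist_sym.
Qed.
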